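(* Let $A$ be a Boolean algebra and $\tau$ be an infinite cardinal number. Then the following conditions are equivalent: (a) $A\in\mathcal{B}\mathcal{S}\mathcal{R}(\tau)$, i.e. $A$ is isomorphic to $RO(X)$ for some semiregular space $X$ with $w(X)=\tau$; (b) $A$ is complete and contains a dense subset $B$ with $|B|=\tau$; (c) $A\in\mathcal{B}\mathcal{Z}\mathcal{K}(\tau)$, i.e. $A$ is isomorphic to $RO(X)$ for some zero-dimensional compact Hausdorff space $X$ with $w(X)=\tau$. Moreover, $\mathcal{B}\mathcal{Z}(\tau)=\mathcal{B}\mathcal{Z}\mathcal{K}(\tau)$, where $\mathcal{B}\mathcal{Z}(\tau)$ is the class of all Boolean algebras isomorphic to $RO(X)$ for some zero-dimensional Hausdorff space $X$ with $w(X)=\tau$.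
   Context: $RO(X)$ is the Boolean algebra of regular open subsets of $X$ (those $U$ with $U=\mathrm{int}(\mathrm{cl}(U))$, ordered by inclusion). A space $X$ is semiregular if $RO(X)$ is a base for $X$. $w(X)$ is the weight of $X$. Zero-dimensional means having a base of clopen sets. A subset $B$ of a Boolean algebra $A$ is dense if for every $a\in A\setminus\{0\}$ there is $b\in B\setminus\{0\}$ with $b\le a$. *)

(* Defs.v *)
From HB Require Import structures.
From mathcomp Require Import all_boot all_order.
From mathcomp Require Import boolp classical_sets functions cardinality.
From mathcomp Require Import topology.

Set Implicit Arguments.
Unset Strict Implicit.
Unset Printing Implicit Defensive.

Import Order.TTheory.

Local Open Scope classical_set_scope.
Local Open Scope card_scope.

Fact regopen_display : Order.disp_t. Proof. by []. Qed.

Record RO (X : topologicalType) := MkRO {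
  ro_set :> set X;
  ro_setP : `[< regopen ro_set >]
}.

HB.instance Definition _ (X : topologicalType) := [isSub for @ro_set X].
HB.instance Definition _ (X : topologicalType) := [Choice of RO X by <:].

Section RegularOpenAlgebra.
Context {X : topologicalType}.
Implicit Types (A B C : set X) (U V W : RO X).

Lemma ro_regopen U : regopen (U : set X).
Proof. exact/asboolP/ro_setP. Qed.

Lemma ro_open U : open (U : set X).
Proof. by rewrite -(ro_regopen U); exact: open_interior. Qed.

Lemma regopen_int_closure A : regopen (closure A)°.
Proof. exact/interior_closed_regopen/closed_closure. Qed.

Lemma open_sub_interior A B : open A -> A `<=` B -> A `<=` B°.
Proof. by move=> /interior_id oA AB; rewrite -oA; exact: interiorS. Qed.

Lemma regopen_setI A B : regopen A -> regopen B -> regopen (A `&` B).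
Proof.
move=> rA rB; rewrite /regopen eqEsubset; split.
  rewrite subsetI; split; [rewrite -{2}rA | rewrite -{2}rB];
    by apply/interiorS/closureS => x [].
apply: open_sub_interior; last exact: subset_closure.
by apply: openI; [rewrite -rA | rewrite -rB]; exact: open_interior.
Qed.

Lemma closure_setI_open A C : open C -> closure A `&` C `<=` closure (A `&` C).
Proof.
move=> oC x [clA Cx] B xB; have xC : nbhs x C by exact: open_nbhs_nbhs.
by rewrite -setIA; apply: clA; exact: filterI.
Qed.

Definition ro_mk A (rA : regopen A) : RO X := MkRO (asboolT rA).

Definition ro_le U V : bool := `[< (U : set X) `<=` V >].

Definition ro_meet U V : RO X := ro_mk (regopen_setI (ro_regopen U) (ro_regopen V)).

Definition ro_join U V : RO X :=
  ro_mk (regopen_int_closure ((U : set X) `|` V)).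

Lemma regopen0 : regopen (@set0 X).
Proof. by rewrite /regopen closure0 interior0. Qed.

Lemma regopenT : regopen [set: X].
Proof. by rewrite /regopen closureT interiorT. Qed.

Definition ro_bot : RO X := ro_mk regopen0.
Definition ro_top : RO X := ro_mk regopenT.

Lemma regopen_int_setC U : regopen (~` (U : set X))°.
Proof. by apply: interior_closed_regopen; apply: open_closedC; exact: ro_open. Qed.

Definition ro_compl U : RO X := ro_mk (regopen_int_setC U).

Lemma ro_le_refl : reflexive ro_le.
Proof. by move=> U; exact/asboolP. Qed.

Lemma ro_le_anti : antisymmetric ro_le.
Proof.
by move=> U V /andP[/asboolP UV /asboolP VU]; apply/val_inj/seteqP; split.
Qed.

Lemma ro_le_trans : transitive ro_le.
Proof.
move=> V U W /asboolP UV /asboolP VW; apply/asboolP.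
exact: subset_trans VW.
Qed.

HB.instance Definition _ := Order.Le_isPOrder.Build regopen_display (RO X)
  ro_le_refl ro_le_anti ro_le_trans.

Lemma ro_leE U V : (U <= V)%O = ((U : set X) `<=` V) :> Prop.
Proof. exact: asboolE. Qed.

Lemma ro_lexI U V W : (U <= ro_meet V W)%O = (U <= V)%O && (U <= W)%O.
Proof.
apply/asboolP/andP => [|[/asboolP UV /asboolP UW]]; rewrite subsetI //.
by move=> [UV UW]; split; exact/asboolP.
Qed.

Lemma ro_leUx U V W : (ro_join U V <= W)%O = (U <= W)%O && (V <= W)%O.
Proof.
have le_join A : A `<=` (U : set X) `|` V -> open A -> A `<=` ro_join U V.
  move=> AUV oA; apply: open_sub_interior => //.
  exact: subset_trans (@subset_closure _ _).
apply/asboolP/andP => [UVW|[/asboolP UW /asboolP VW]].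
  split; apply/asboolP; apply: subset_trans UVW; apply: le_join.
  - by move=> x; left.
  - exact: ro_open.
  - by move=> x; right.
  - exact: ro_open.
by rewrite -(ro_regopen W); apply/interiorS/closureS; rewrite subUset.
Qed.

HB.instance Definition _ := Order.POrder_MeetJoin_isLattice.Build
  regopen_display (RO X) ro_lexI ro_leUx.

Lemma ro_meetUl : @left_distributive (RO X) (RO X) Order.meet Order.join.
Proof.
move=> U V W; apply/le_anti/andP; split; last first.
  by rewrite leUx !lexI leIr (le_trans (leIl _ _) (leUl _ _)) leIr
             (le_trans (leIl _ _) (leUr _ _)).
rewrite ro_leE; apply: open_sub_interior; first exact: ro_open.
rewrite -setIUl; apply: subset_trans (closure_setI_open (ro_open W)).
by apply: setSI; exact: interior_subset.
Qed.

HB.instance Definition _ := Order.Lattice_Meet_isDistrLattice.Build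
  regopen_display (RO X) ro_meetUl.

Lemma ro_le0x U : (ro_bot <= U)%O.
Proof. by rewrite ro_leE; exact: sub0set. Qed.

Lemma ro_lex1 U : (U <= ro_top)%O.
Proof. by rewrite ro_leE. Qed.

HB.instance Definition _ :=
  Order.hasBottom.Build regopen_display (RO X) ro_le0x.
HB.instance Definition _ :=
  Order.hasTop.Build regopen_display (RO X) ro_lex1.

Lemma ro_joinxC U : (U `|` ro_compl U)%O = \top%O.
Proof.
apply/val_inj; rewrite /= interiorC closureU.
apply/seteqP; split=> // x _.
apply: open_sub_interior (I : setT x); first exact: openT.
move=> y _; have [|nUy] := pselect (closure (U : set X) y); first by left.
by right; exact: subset_closure.
Qed.

Lemma ro_meetxC U : (U `&` ro_compl U)%O = \bot%O.
Proof.
apply/val_inj/seteqP; split=> // x [Ux /interior_subset]; exact.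
Qed.

HB.instance Definition _ := Order.TBDistrLattice_hasComplement.Build
  regopen_display (RO X) ro_joinxC ro_meetxC.

Lemma ro_meetE U V : (U `&` V)%O = (U : set X) `&` V :> set X.
Proof. by []. Qed.

Lemma ro_joinE U V : (U `|` V)%O = (closure ((U : set X) `|` V))° :> set X.
Proof. by []. Qed.

Lemma ro_complE U : (~` U)%O = (~` (U : set X))° :> set X.
Proof. by []. Qed.

End RegularOpenAlgebra.

Definition semiregular (X : topologicalType) := basis [set U : set X | regopen U].

(* The library's zero_dimensional only asks clopen sets to separate points,
   which is weaker than having a base of clopen sets. *)
Definition has_clopen_basis (X : topologicalType) :=
  exists2 B : set (set X), basis B & B `<=` clopen.

(* Cardinal numbers are represented by types: tau stands for the cardinality of
   [set: tau]. *)
Definition weight_is (X : topologicalType) (tau : Type) :=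
  (exists2 B : set (set X), basis B & B #= [set: tau]) /\
  (forall B : set (set X), basis B -> [set: tau] #<= B).

Definition ba_isomorphic d (A : ctbDistrLatticeType d)
    d' (A' : ctbDistrLatticeType d') :=
  exists f : A -> A', bijective f /\
    [/\ {morph f : x y / (x `&` y)%O >-> (x `&` y)%O},
        {morph f : x y / (x `|` y)%O >-> (x `|` y)%O},
        {morph f : x / (~` x)%O >-> (~` x)%O},
        f \bot%O = \bot%O & f \top%O = \top%O].

Definition ba_complete d (A : ctbDistrLatticeType d) :=
  forall S : set A, supremums S !=set0.

Definition ba_dense d (A : ctbDistrLatticeType d) (B : set A) :=
  forall a : A, a != \bot%O -> exists b : A, [/\ B b, b != \bot%O & (b <= a)%O].

Definition BSR (tau : Type) d (A : ctbDistrLatticeType d) :=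
  exists X : topologicalType,
    [/\ semiregular X, weight_is X tau & ba_isomorphic A (RO X)].

Definition BZ (tau : Type) d (A : ctbDistrLatticeType d) :=
  exists X : topologicalType,
    [/\ has_clopen_basis X, hausdorff_space X, weight_is X tau
      & ba_isomorphic A (RO X)].

Definition BZK (tau : Type) d (A : ctbDistrLatticeType d) :=
  exists X : topologicalType,
    [/\ has_clopen_basis X, compact [set: X], hausdorff_space X,
        weight_is X tau & ba_isomorphic A (RO X)].

(* Main.v *)
Require Import Defs.
From HB Require Import structures.
From mathcomp Require Import all_boot all_order.
From mathcomp Require Import finmap.
From mathcomp Require Import boolp classical_sets functions cardinality topology.

(** The implications from (c) to (a) and from (c) to [BZ] only forget properties
of the space, a base of clopen sets being a base of regular open sets.

From (a) to (b): [RO X] is complete, and if [B] is a base of a semiregular space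
then so is the set of all int(cl(U)), [U] in [B]; it is dense in [RO X], and its
cardinality is at most that of [B], hence is the weight when [B] is minimal.

From (b) to (c): enumerate the dense set as [b : tau -> A] and let [X] be the
closed subspace of the Cantor cube 2^tau formed by the [x] such that every
finite meet of elements [b i] (if [x i]) and [~ b i] (otherwise) is nonzero; this
is the Stone space of the subalgebra generated by [b].  An element [a] of [A]
corresponds to the union of the basic clopen sets whose meet is below [a]: by
density it is the interior of the complement of the open set attached to the
complement of [a], hence is regular open, and completeness makes every regular
open set of this form.  The weight of [X] is at most the number of finite words
on tau, and at least tau because the tau distinct clopen sets [x i = true] are
finite unions of members of any base.  Both bounds rest on the equality of the
cardinals of [seq T] and [T] for infinite [T], which follows from Zorn's lemma. *)

Set Implicit Arguments.
Unset Strict Implicit.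
Unset Printing Implicit Defensive.

Import Order.TTheory Order.CTheory Order.CTBDistrLatticeTheory.

Local Open Scope classical_set_scope.
Local Open Scope card_scope.

(** * Comparability of cardinals *)

(** Zorn's lemma gives a maximal graph [G] of a partial injection. If some [x] of [A] is outside its
    domain, its range is all of [B], since a missed [y] would allow adding [(x, y)]. *)
Lemma card_le_total T U (A : set T) (B : set U) : A #<= B \/ B #<= A.
Proof.
elim/Ppointed: T => T in A *; first by left; rewrite !emptyE.
elim/Ppointed: U => U in B *; first by right; rewrite !emptyE.
pose P (G : set (T * U)) := G `<=` A `*` B /\
  forall p q, G p -> G q -> p.1 = q.1 <-> p.2 = q.2.
have [|G [[GAB Ginj] Gmax]] := @Zorn_bigcup _ P.
  move=> F FP Ftot; split; first by move=> p [G /FP[+ _]]; apply.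
  move=> p q [G FG Gp] [H FH Hq]; have [GH|HG] := Ftot _ _ FG FH.
    by have [_] := FP _ FH; apply => //; exact: GH.
  by have [_] := FP _ FG; apply => //; exact: HG.
have [domG|] := pselect (forall x, A x -> exists y, G (x, y)).
  have /choice[f fP] : forall x, exists y, A x -> G (x, y).
    by move=> x; have [/domG[y]|] := pselect (A x); [exists y|exists point].
  left; apply/pcard_leP/injfunPex; exists f.
    by move=> x /fP /GAB[].
  by move=> x y /set_mem/fP Gx /set_mem/fP Gy /(Ginj _ _ Gx Gy).
move=> /existsNP[x /not_implyP[Ax xG]].
have ranG y : B y -> exists x, G (x, y).
  move=> By; apply: contrapT => yG.
  apply: (Gmax (G `|` [set (x, y)])).
    split; first by move=> p; left.
    by move=> /(_ (x, y)) Gxy; apply: xG; exists y; apply: Gxy; right.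
  split; first by move=> p [/GAB//|->].
  move=> [p1 p2] [q1 q2] [Gp|[-> ->]] [Gq|[-> ->]] //=.
    exact: Ginj _ _ Gp Gq.
    split=> e; first by case: xG; exists p2; rewrite -e.
    by case: yG; exists p1; rewrite -e.
  split=> e; first by case: xG; exists q2; rewrite e.
  by case: yG; exists q1; rewrite e.
have /choice[f fP] : forall y, exists x, B y -> G (x, y).
  by move=> y; have [/ranG[z]|] := pselect (B y); [exists z|exists point].
right; apply/pcard_leP/injfunPex; exists f.
  by move=> y /fP /GAB[].
by move=> y z /set_mem/fP Gy /set_mem/fP Gz /(Ginj _ _ Gy Gz).
Qed.

(** * Words over an infinite set *)

Section SeqCardinality.
Context {T : pointedType}.
Implicit Types (A B D S : set T) (f k : T -> T) (g : seq T -> T) (l : seq T).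

(* The empty sequence is excluded so that the empty graph, which Zorn's lemma
   requires as the union of the empty chain, is the graph of an embedding. *)
Definition nonempty_seq_on A l := l != [::] /\ {in l, forall t, A t}.

Definition seq_embedding A B g :=
  (forall l, nonempty_seq_on A l -> B (g l)) /\
  (forall l l', nonempty_seq_on A l -> nonempty_seq_on A l' ->
    g l = g l' -> l = l').

Lemma nonempty_seq_on1 A t : A t -> nonempty_seq_on A [:: t].
Proof. by move=> At; split=> // x; rewrite inE => /eqP->. Qed.

Lemma nonempty_seq_onS A B l :
  A `<=` B -> nonempty_seq_on A l -> nonempty_seq_on B l.
Proof. by move=> AB [l0 Al]; split=> // t /Al /AB. Qed.

(* An element of S is coded by a one-letter word over S, an element t of D by
   the two-letter word (k t)(k t). *)
Lemma seq_embedding_extend S D g k : seq_embedding S S g ->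
    (forall t, D t -> S (k t)) ->
    (forall t u, D t -> D u -> k t = k u -> t = u) ->
  exists g', seq_embedding (S `|` D) S g'.
Proof.
move=> [gS ginj] kS kinj.
pose c t := if t \in S then g [:: t] else g [:: k t; k t].
have on2 t : D t -> nonempty_seq_on S [:: k t; k t].
  by move=> /kS St; split=> // x; rewrite !inE orbb => /eqP->.
have cS t : (S `|` D) t -> S (c t).
  rewrite /c; case: ifPn => [/set_mem St _|/negP nSt [/mem_set//|Dt]].
    by apply: gS; exact: nonempty_seq_on1.
  by apply: gS; exact: on2.
have cinj t u : (S `|` D) t -> (S `|` D) u -> c t = c u -> t = u.
  rewrite /c; case: ifPn => [/set_mem St _|/negP nSt [/mem_set//|Dt]];
    case: ifPn => [/set_mem Su _|/negP nSu [/mem_set//|Du]] /ginj e.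
  - by have [] := e (nonempty_seq_on1 St) (nonempty_seq_on1 Su).
  - by have := e (nonempty_seq_on1 St) (on2 _ Du).
  - by have := e (on2 _ Dt) (nonempty_seq_on1 Su).
  - by have [/kinj ->] := e (on2 _ Dt) (on2 _ Du).
have mapcS l : nonempty_seq_on (S `|` D) l -> nonempty_seq_on S (map c l).
  move=> [l0 lSD]; split; first by case: l l0 {lSD}.
  by move=> _ /mapP[t /lSD SDt ->]; exact: cS.
exists (g \o map c); split=> [l /mapcS|l l' onl onl']; first exact: gS.
move=> /(ginj _ _ (mapcS _ onl) (mapcS _ onl')).
move: onl onl' => [_ lSD] [_ l'SD].
elim: l => [|t l IH] in l' lSD l'SD *; first by case: l' {l'SD}.
case: l' => [//|t' l'] in l'SD * => -[/cinj -> ].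
- move=> /IH -> // u ul; first by apply: lSD; rewrite inE ul orbT.
  by apply: l'SD; rewrite inE ul orbT.
- by apply: lSD; exact: mem_head.
- by apply: l'SD; exact: mem_head.
Qed.

Definition seq_graph S g : set (seq T * T) :=
  [set p | nonempty_seq_on S p.1 /\ p.2 = g p.1].

(** A word has finitely many letters, so one member of the chain already has all of them in its
    alphabet and codes the word; two words are compared in the larger of their graphs. *)
Lemma seq_graph_bigcup (F : set (set (seq T * T))) :
    F `<=` [set G | exists S g, seq_embedding S S g /\ G = seq_graph S g] ->
    total_on F subset ->
  exists S g, seq_embedding S S g /\ \bigcup_(G in F) G = seq_graph S g.
Proof.
move=> FP Ftot; pose S := [set t | exists2 G, F G & exists y, G ([:: t], y)].
have onF l : nonempty_seq_on S l ->
    exists S' g', [/\ F (seq_graph S' g'), seq_embedding S' S' g'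
      & nonempty_seq_on S' l].
  move=> [l0 lS]; elim: l => [//|t l IH] in l0 lS *.
  have [|G FG [y Gty]] := lS t; first exact: mem_head.
  have [S1 [g1 [emb1 eG]]] := FP _ FG.
  have S1t : S1 t.
    by move: Gty; rewrite eG => -[[_ +] _]; apply; exact: mem_head.
  have [l_nil|ln] := eqVneq l [::].
    exists S1, g1; rewrite -eG l_nil; split=> //; exact: nonempty_seq_on1.
  have [//||S2 [g2 [F2 emb2 [_ lS2]]]] := IH.
    by move=> u ul; apply: lS; rewrite inE ul orbT.
  rewrite eG in FG; have [S12|S21] := Ftot _ _ FG F2.
    have S2t : S2 t.
      have [|[_ +] _] := S12 ([:: t], g1 [:: t]).
        by split=> //; exact: nonempty_seq_on1.
      by apply; exact: mem_head.
    exists S2, g2; split=> //; split=> // u; rewrite inE => /predU1P[->//|].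
    exact: lS2.
  exists S1, g1; split=> //; split=> // u; rewrite inE => /predU1P[->//|ul].
  have [|[_ +] _] := S21 ([:: u], g2 [:: u]).
    by split=> //; apply/nonempty_seq_on1/lS2.
  by apply; exact: mem_head.
have FS S' g' : F (seq_graph S' g') -> S' `<=` S.
  move=> FG t S't; exists (seq_graph S' g') => //; exists (g' [:: t]).
  by split=> //; exact: nonempty_seq_on1.
have /choice[g gP] l : exists y,
    nonempty_seq_on S l -> (\bigcup_(G in F) G) (l, y).
  have [/onF[S' [g' [FG' _ onl]]]|] := pselect (nonempty_seq_on S l).
    by exists (g' l) => _; exists (seq_graph S' g').
  by exists point.
have Finj p q : (\bigcup_(G in F) G) p -> (\bigcup_(G in F) G) q ->
    p.1 = q.1 <-> p.2 = q.2.
  have same (G : set (seq T * T)) : F G -> G p -> G q ->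
      p.1 = q.1 <-> p.2 = q.2.
    move=> /FP[S' [g' [[_ ginj] ->]]] [onp ->] [onq ->].
    by split=> [->//|]; exact: ginj.
  move=> [G FG Gp] [H FH Hq]; have [GH|HG] := Ftot _ _ FG FH.
    by apply: same FH _ _ => //; exact: GH.
  by apply: same FG _ _ => //; exact: HG.
exists S, g; split; first split.
- move=> l /gP[G FG]; have [S' [g' [[g'S' _] eG]]] := FP _ FG.
  by rewrite eG => -[onl /= ->]; apply: (FS S' g'); rewrite -?eG//; exact: g'S'.
- by move=> l l' /gP Fl /gP Fl' /(Finj _ _ Fl Fl').
apply/seteqP; split=> [[l y] Fly|[l y] [/= onl ->]]; last exact: gP.
have onl : nonempty_seq_on S l.
  have [G FG] := Fly; have [S' [g' [_ eG]]] := FP _ FG.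
  rewrite eG => -[/= onl _]; apply: nonempty_seq_onS onl.
  by apply: (FS S' g'); rewrite -eG.
by split=> //=; exact/(Finj _ _ Fly (gP _ onl)).
Qed.

Lemma seq_graph_proper S S' g g' : S `<` S' ->
    (forall l, nonempty_seq_on S l -> g l = g' l) ->
  seq_graph S g `<` seq_graph S' g'.
Proof.
move=> [SS' S'S] gg'; split.
  by move=> [l y] [/= onl ->]; split; [exact: nonempty_seq_onS onl|exact: gg'].
move=> G'G; apply: S'S => t S't.
have [|[_ +] _] := G'G ([:: t], g' [:: t]).
  by split=> //; exact: nonempty_seq_on1.
by apply; exact: mem_head.
Qed.

(** Take a maximal [S] whose words embed in [S]. Either the complement of [S] embeds in [S] and the
    code extends to all of [T], or a disjoint copy of [S] can be adjoined, against maximality. *)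
Lemma card_seq_le_pointed : infinite_set [set: T] -> [set: seq T] #<= [set: T].
Proof.
move=> /infiniteP/pcard_injP[e einj0].
have einj : injective e by move=> m n; apply: einj0; rewrite inE.
have [G [[S [g [emb eG]]] Gmax]] := Zorn_bigcup seq_graph_bigcup.
have Smax S' g' : S `<` S' -> (forall l, nonempty_seq_on S l -> g l = g' l) ->
    ~ seq_embedding S' S' g'.
  move=> SS' gg' emb'; apply: (Gmax (seq_graph S' g')).
    by rewrite eG; exact: seq_graph_proper.
  by exists S', g'.
have S0 : S !=set0.
  apply: contrapT => /nonemptyPn S0.
  have [e' e'K] : exists e' : T -> nat, cancel e e'.
    have /choice[e' e'P] : forall t, exists n, forall m, t = e m -> n = m.
      move=> t; have [[m ->]|ne] := pselect (exists m, t = e m).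
        by exists m => m' /einj.
      by exists 0 => m tem; case: ne; exists m.
    by exists e' => m; exact: e'P.
  have rangeK l : {in l, forall t, range e t} -> map e (map e' l) = l.
    move=> le; rewrite -map_comp -[RHS]map_id; apply/eq_in_map => t /le[n _ <-].
    by rewrite /= e'K.
  (* If [S] is empty, the countable set [range e] with the numbering of words over [nat] contradicts
     maximality. *)
  apply: (Smax (range e) (fun l => e (choice.pickle (map e' l)))).
  - by rewrite S0; split=> //; move=> /(_ (e 0)); apply; exists 0.
  - by rewrite S0 => l [l0 l_S]; case: l l0 l_S => // t l _ /(_ t)[]; exact: mem_head.
  - split=> [l _|l l' [_ le] [_ l'e] /einj /(pcan_inj choice.pickleK) ll'].
      by exists (choice.pickle (map e' l)).
    by rewrite -(rangeK l)// -(rangeK l')// ll'.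
have [SnS|nSS] := card_le_total S (~` S).
  move/pcard_leP/injfunPex: SnS => [h hnS hinj].
  have /choice[k kP] : forall t, exists u, (h @` S) t -> S u /\ h u = t.
    move=> t; have [[u Su <-]|nht] := pselect ((h @` S) t); first by exists u.
    by exists point.
  have [|t u hSt hSu kk|g' [g'S g'inj]] := @seq_embedding_extend S (h @` S) g k emb.
  - by move=> t /kP[].
  - by have [_ <-] := kP _ hSt; have [_ <-] := kP _ hSu; rewrite kk.
  have hg' l : nonempty_seq_on (S `|` h @` S) l -> (h @` S) (h (g' l)).
    by move=> onl; exists (g' l) => //; exact: g'S.
  (* Words over [S] keep their code; all others are sent by [h] outside [S], so the two kinds of
     codes never collide. *)
  exfalso; apply: (Smax (S `|` h @` S)
    (fun l => if `[< nonempty_seq_on S l >] then g l else h (g' l))).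
  - split; first by move=> t; left.
    have [s Ss] := S0; move=> /(_ (h s)) sub; apply: (hnS s Ss); apply: sub.
    by right; exists s.
  - by move=> l onl; rewrite asboolT.
  - have [gS ginj] := emb; split=> [l onl|l l' onl onl'].
      by case: asboolP => [/gS Sgl|_]; [left|right; exact: hg'].
    case: asboolP => [onSl|_]; case: asboolP => [onSl'|_].
    + exact: ginj.
    + by move=> ghg; have := hnS _ (g'S _ onl'); rewrite -ghg => /(_ (gS _ onSl)).
    + by move=> ghg; have := hnS _ (g'S _ onl); rewrite ghg => /(_ (gS _ onSl')).
    + by move=> /hinj ghg; apply: g'inj => //; apply: ghg; apply/mem_set/g'S.
move/pcard_leP/injfunPex: nSS => [k kS kinj].
have [|g' [_]] := @seq_embedding_extend S (~` S) g k emb kS.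
  by move=> t u nt nu; apply: kinj; exact/mem_set.
rewrite setUv => g'inj; apply/pcard_injP.
(* Prefixing [point] makes every word nonempty, so that the empty word is coded as well. *)
have on l : nonempty_seq_on [set: T] (point :: l) by split.
by exists (fun l => g' (point :: l)) => l l' _ _ /(g'inj _ _ (on l) (on l'))[].
Qed.

End SeqCardinality.

Lemma card_seq_le T : infinite_set [set: T] -> [set: seq T] #<= [set: T].
Proof.
elim/Ppointed: T => T; last exact: card_seq_le_pointed.
by move=> /infinite_setN0[x]; case: (no x).
Qed.

(** * The Stone space of the subalgebra generated by a family *)

Section BooleanSubbaseSpace.
Context d (A : ctbDistrLatticeType d) (I : Type) (b : I -> A).
Implicit Types (a z : A) (s t : seq (I * bool)) (f : I -> bool).
Local Open Scope order_scope.

Definition literal (p : I * bool) : A := if p.2 then b p.1 else ~` b p.1.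

Definition word_meet s : A := \meet_(p <- s) literal p.

Definition agrees f s := all (fun p => f p.1 == p.2) s.

(** A point codes an ultrafilter of the subalgebra by the set of generators it contains. *)
Record space := Space {
  space_fun :> I -> bool;
  space_consistent : forall s, agrees space_fun s -> word_meet s != \bot
}.

HB.instance Definition _ := gen_eqMixin space.
HB.instance Definition _ := gen_choiceMixin space.

Definition cylinder s : set space := [set x : space | agrees x s].

Definition space_open (U : set space) :=
  forall x, U x -> exists2 s, cylinder s x & (cylinder s `<=` U)%classic.

Lemma cylinder_cat s t : cylinder (s ++ t) = (cylinder s `&` cylinder t)%classic.
Proof.
apply/seteqP; split=> x /=; rewrite /cylinder /agrees /= all_cat; by move/andP.
Qed.

Lemma space_openT : space_open [set: space].
Proof. by move=> x _; exists [::]. Qed.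

Lemma space_openI : setI_closed space_open.
Proof.
move=> U V oU oV x [/oU[s xs sU] /oV[t xt tV]].
by exists (s ++ t); rewrite cylinder_cat; [split|exact: setISS].
Qed.

Lemma space_open_bigU (J : Type) (F : J -> set space) :
  (forall j, space_open (F j)) -> space_open (\bigcup_j F j).
Proof.
move=> oF x [j _ /oF[s xs sF]]; exists s => //.
by apply: subset_trans sF _; exact: bigcup_sup.
Qed.

HB.instance Definition _ :=
  isOpenTopological.Build space space_openT space_openI space_open_bigU.

Lemma le_word_meet z s : (z <= word_meet s) = all (fun p => z <= literal p) s.
Proof.
rewrite /word_meet; elim: s => [|p s IH]; first by rewrite big_nil lex1.
by rewrite big_cons lexI IH.
Qed.

Lemma word_meet_cat s t : word_meet (s ++ t) = word_meet s `&` word_meet t.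
Proof. exact: big_cat. Qed.

Lemma word_meet1 p : word_meet [:: p] = literal p.
Proof. exact: big_seq1. Qed.

Lemma cylinder1 i c : cylinder [:: (i, c)] = [set x : space | x i = c].
Proof.
apply/seteqP; split=> x; rewrite /cylinder /agrees /= andbT; by move/eqP.
Qed.

Lemma open_cylinder s : open (cylinder s).
Proof. by move=> x xs; exists s. Qed.

Lemma clopen_cylinder s : clopen (cylinder s).
Proof.
split; first exact: open_cylinder.
elim: s => [|[i c] s IH].
  by have -> : cylinder [::] = [set: space] by apply/seteqP.
rewrite -cat1s cylinder_cat; apply: closedI => //.
rewrite -[cylinder _]setCK; apply: open_closedC.
suff -> : (~` cylinder [:: (i, c)])%classic = cylinder [:: (i, ~~ c)].
  exact: open_cylinder.
by rewrite !cylinder1; apply/seteqP; split=> x /=; case: (x i) c => [] [].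
Qed.

Lemma cylinder_basis : basis (range cylinder).
Proof.
split; first by move=> _ [s _ <-]; exact: open_cylinder.
move=> x U; rewrite nbhsE => -[V [oV Vx] VU].
have [s xs sV] := oV _ Vx; exists (cylinder s); first by split=> //; exists s.
exact: subset_trans VU.
Qed.

Lemma space_clopen_basis : has_clopen_basis space.
Proof.
exists (range cylinder); first exact: cylinder_basis.
by move=> _ [s _ <-]; exact: clopen_cylinder.
Qed.

Lemma space_hausdorff : hausdorff_space space.
Proof.
move=> x y xy; have fxy : x = y :> (I -> bool).
  apply/funext => i.
  have [||z] := xy (cylinder [:: (i, x i)]) (cylinder [:: (i, y i)]).
  - by apply: open_nbhs_nbhs; split; [exact: open_cylinder|rewrite cylinder1].
  - by apply: open_nbhs_nbhs; split; [exact: open_cylinder|rewrite cylinder1].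
  - by rewrite !cylinder1 => -[/= <- <-].
case: x y fxy {xy} => [f fc] [g gc] /= fg.
by rewrite fg in fc *; congr Space; exact: Prop_irrelevance.
Qed.

(** An ultrafilter [W] converges to the point recording, for each [i], which of the two cylinders at
    [i] is in [W]. This point is consistent because every cylinder in [W] is inhabited. *)
Lemma space_compact : compact [set: space].
Proof.
rewrite compact_ultra => W UW _.
pose f i := `[< W (cylinder [:: (i, true)]) >].
have Wf i : W (cylinder [:: (i, f i)]).
  rewrite /f; case: asboolP => // nWi.
  have [//|] := in_ultra_setVsetC (cylinder [:: (i, true)]) UW.
  by apply: filterS => x; rewrite !cylinder1 /=; case: (x i).
have Wcyl s : agrees f s -> W (cylinder s).
  elim: s => [_|[i c] s IH /= /andP[/eqP <- /IH Ws]].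
    by apply: filterS filterT.
  by rewrite -cat1s cylinder_cat; exact: filterI.
have fcons s : agrees f s -> word_meet s != \bot.
  move=> /Wcyl /filter_ex[x]; exact: space_consistent.
exists (Space fcons); split=> // U; rewrite nbhsE => -[V [oV Vf] VU].
have [s /Wcyl Ws sV] := oV _ Vf.
exact: filterS (subset_trans sV VU) Ws.
Qed.

(* Only finitely many elements are decided by a nonzero z at a time, but these
   finite decisions have the finite intersection property: an ultrafilter on
   the set A decides all b i at once. *)
Lemma cylinder_neq0 s : word_meet s != \bot -> exists x, cylinder s x.
Proof.
set a := word_meet s => a0.
pose E (r : seq I) : set A := [set z | [/\ z != \bot, z <= a
  & all (fun i => (z <= b i) || (z <= ~` b i)) r]].
have E0 r : E r !=set0.
  elim: r => [|i r [z [z0 za zr]]]; first by exists a; split.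
  have sub y : y <= z -> all (fun i => (y <= b i) || (y <= ~` b i)) r.
    move=> yz; apply: sub_all zr => j /orP[|] zj.
      by rewrite (le_trans yz zj).
    by rewrite (le_trans yz zj) orbT.
  (* Either [z] is disjoint from [b i], hence below its complement, or the part of [z] in [b i] is
     nonzero and below [b i]. *)
  have [zi|zi] := eqVneq (z `&` b i) \bot.
    by exists z; split; rewrite //= -disj_leC zi eqxx orbT.
  exists (z `&` b i); split=> //=; first by rewrite leIxl.
  by rewrite leIr sub ?leIl.
have FF : ProperFilter (filter_from setT E).
  apply: filter_from_proper => [|r _]; last exact: E0.
  apply: filter_fromT_filter => [|r r']; first by exists [::].
  by exists (r ++ r') => z [z0 za]; rewrite all_cat => /andP[].
have [W [UW FW]] := ultraFilterLemma FF.
have WE r : W (E r) by apply: FW; exists r.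
pose f i := `[< W [set z | z <= b i] >].
(* [W]-almost every [z] is nonzero and decides [b i], so it is below exactly one of the two
   literals. *)
have fP p : f p.1 = p.2 <-> W [set z | z <= literal p].
  case: p => i [] /=; rewrite /literal /=; first by split=> /asboolP.
  split=> [/asboolP nWi|Wni].
    have [//|Wn] := in_ultra_setVsetC [set z | z <= b i] UW.
    apply: filterS (filterI Wn (WE [:: i])) => z /= [zi [_ _ /=]].
    by rewrite andbT => /orP[].
  apply/asboolP => Wi; apply: (@filter_not_empty _ W).
  apply: filterS (filterI (filterI Wi Wni) (WE [::])) => z /= [[zi zni] [z0 _ _]].
  by move/negP: z0; apply; rewrite -lex0 -(meetxC (b i)) lexI zi.
have Wmeet t : agrees f t -> W [set z | z <= word_meet t].
  move=> ft; suff: W [set z | all (fun p => z <= literal p) t].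
    by apply: filterS => z; rewrite /= le_word_meet.
  elim: t ft => [_|p t IH /= /andP[/eqP/fP Wp /IH Wt]].
    by apply: filterS filterT.
  by apply: filterS (filterI Wp Wt) => z /= [-> ->].
have fcons t : agrees f t -> word_meet t != \bot.
  move=> /Wmeet Wt; apply/eqP => t0; apply: (@filter_not_empty _ W).
  apply: filterS (filterI Wt (WE [::])) => z /= [+ [z0 _ _]].
  by rewrite t0 lex0 (negbTE z0).
have af t : a <= word_meet t -> agrees f t.
  rewrite le_word_meet; elim: t => //= p t IH /andP[ap at'].
  apply/andP; split; last exact: IH.
  by apply/eqP/fP; apply: filterS (WE [::]) => z [_ za _]; exact: le_trans ap.
by exists (Space fcons); exact: af.
Qed.

Lemma word_meet_cap_neq0 x s t : cylinder s x -> cylinder t x ->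
  word_meet s `&` word_meet t != \bot.
Proof.
move=> xs xt; rewrite -word_meet_cat; apply: (@space_consistent x).
by rewrite /agrees all_cat; exact/andP.
Qed.

Context (b_dense : forall a, a != \bot -> exists2 i, b i != \bot & b i <= a).

Definition space_of a : set space :=
  \bigcup_(s in [set s | word_meet s <= a]) cylinder s.

Lemma open_space_of a : open (space_of a).
Proof. by apply: bigcup_open => s _; exact: open_cylinder. Qed.

(** Cylinders sharing a point have words with nonzero meet, so the sets of [a] and of its complement
    are disjoint. If [cylinder s] misses the latter but [word_meet s] is not below [a], density
    gives a nonzero [b i] below the difference, and a point of [cylinder s] with value true at [i]
    is a contradiction. *)
Lemma space_ofC a : space_of a = ((~` space_of (~` a)%O)°)%classic.
Proof.
apply/seteqP; split.
  apply: open_sub_interior; first exact: open_space_of.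
  move=> x [s /= sa xs] [t /= ta xt].
  have /negP := word_meet_cap_neq0 xs xt; apply.
  by rewrite -lex0 -(meetxC a) leI2.
move=> x; rewrite /interior nbhsE => -[V [oV Vx] Va].
have [s xs sV] := oV _ Vx; exists s => //=.
rewrite -[a]complK -disj_leC.
apply: contrapT => /negP /b_dense[i bi0]; rewrite lexI => /andP[bis bia].
have [|y /=] := @cylinder_neq0 (s ++ [:: (i, true)]).
  by rewrite word_meet_cat word_meet1 /literal /= (meet_r bis).
rewrite cylinder_cat => -[ys yi]; apply: (Va y); first exact: sV.
by exists [:: (i, true)] => //=; rewrite word_meet1.
Qed.

Lemma regopen_space_of a : regopen (space_of a).
Proof.
rewrite space_ofC; apply/interior_closed_regopen/open_closedC.
exact: open_space_of.
Qed.

Lemma space_of_subset a a' : (space_of a `<=` space_of a')%classic -> a <= a'.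
Proof.
move=> aa'; rewrite -[a']complK -disj_leC.
apply: contrapT => /negP /b_dense[i bi0]; rewrite lexI => /andP[bia bia'].
have [|x xi] := @cylinder_neq0 [:: (i, true)]; first by rewrite word_meet1.
have [|s /= sa' xs] := aa' x.
  by exists [:: (i, true)] => //=; rewrite word_meet1.
have /negP := word_meet_cap_neq0 xs xi; apply; rewrite word_meet1.
by rewrite -lex0 -(meetxC a') leI2.
Qed.

Lemma space_of_surj (U : set space) : ba_complete A -> regopen U ->
  exists a, space_of a = U.
Proof.
move=> Acomplete rU.
(* The preimage of [U] is the supremum of the words whose cylinders lie in [U]. *)
have [a [a_ub a_lub]] :=
  Acomplete (word_meet @` [set s | (cylinder s `<=` U)%classic]).
have oU : open U by rewrite -rU; exact: open_interior.
exists a; apply/seteqP; split; last first.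
  by move=> x /oU[s xs sU]; exists s => //=; apply: a_ub; exists s.
rewrite -rU; apply: open_sub_interior; first exact: open_space_of.
move=> x [s /= sa xs] B; rewrite nbhsE => -[V [oV Vx] VB].
have [t xt tV] := oV _ Vx; apply: contrapT => UB.
have /negP := word_meet_cap_neq0 xs xt; apply.
(* As [cylinder t] misses [U], the complement of [word_meet t] bounds all words with cylinder in
   [U], hence bounds [a]. *)
rewrite disj_leC (le_trans sa)//.
apply: a_lub => _ [r /= rU' <-].
rewrite -disj_leC; apply: contrapT => /negP.
rewrite -word_meet_cat => /cylinder_neq0[y]; rewrite cylinder_cat => -[yr yt].
by apply: UB; exists y; split; [exact: rU'|apply: VB; exact: tV].
Qed.

End BooleanSubbaseSpace.

Arguments cylinder {d A I} b s.

(** * Cardinalities of words and of bases *)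

Lemma card_eq_enum T I (B : set T) : B #= [set: I] ->
  exists b : I -> T, injective b /\ range b = B.
Proof.
move=> /card_esym/card_bijP[g [g' gK g'K]].
exists (fun i => val (g (SigSub (in_setT i)))); split.
  by move=> i j /val_inj /(can_inj gK) [].
apply/seteqP; split=> [_ [i _ <-]|t Bt]; first exact: set_valP.
exists (val (g' (SigSub (mem_set Bt)))) => //.
set i := SigSub _; have -> : i = g' (SigSub (mem_set Bt)) by apply: val_inj.
by rewrite g'K.
Qed.

Lemma card_le_injective T U (f : T -> U) :
  injective f -> [set: T] #<= [set: U].
Proof.
move=> finj; have /card_eqPle[_ +] : f @` setT #= [set: T].
  by apply: inj_card_eq => x y _ _; exact: finj.
by move=> /card_le_trans; apply; exact: card_leT.
Qed.

Lemma infinite_card_le T U (A : set T) (B : set U) :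
  infinite_set A -> A #<= B -> infinite_set B.
Proof. by move=> Ainf AB /(card_le_finite AB). Qed.

(** The pair [(x, c)] is coded by one or two copies of [x], which turns a word over [T * bool] into
    a word of words over [T]. *)
Lemma card_seq_bool_le T :
  infinite_set [set: T] -> [set: seq (T * bool)] #<= [set: T].
Proof.
move=> Tinf; have seqT := card_seq_le Tinf.
have seqinf : infinite_set [set: seq T].
  apply: infinite_card_le Tinf _.
  by apply: (@card_le_injective _ _ (cons^~ [::])) => x y [].
apply: card_le_trans seqT; apply: card_le_trans (card_seq_le seqinf).
apply: (@card_le_injective _ _ (map (fun p : T * bool => nseq p.2.+1 p.1))).
by apply: inj_map => -[x []] [y []] //= [->].
Qed.

Lemma seq_val_onto T (B : set T) (l : seq T) :
  all (fun x => x \in B) l -> exists s : seq B, map val s = l.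
Proof.
elim: l => [_|x l IH /= /andP[xB /IH[s <-]]]; first by exists [::].
by exists (SigSub xB :: s).
Qed.

Lemma compact_open_finite_union (X : topologicalType) (B : set (set X))
    (C : set X) : basis B -> compact C -> open C ->
  exists D : {fset set X}, {subset D <= B} /\ C = \bigcup_(U in [set` D]) U.
Proof.
move=> [Bopen Bnbhs] Cc Co; have [->|/set0P[c _]] := eqVneq C set0.
  by exists fset0; split=> //; rewrite set_fset0 bigcup_set0.
(* [compact_cover] is applied to a pointed space; [c] serves as base point. *)
pose pX : ptopologicalType := HB.pack X (isPointed.Build X c).
have : @compact pX C := Cc.
rewrite compact_cover => /(_ _ [set U | B U /\ U `<=` C] id)[|x Cx|D DB CD].
- by move=> U [/Bopen].
- have [U [BU Ux] UC] := Bnbhs x C (open_nbhs_nbhs (conj Co Cx)).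
  by exists U.
- exists D; split; first by move=> U /DB/set_mem[BU _]; exact/mem_set.
  by apply/seteqP; split=> // x [U /DB/set_mem[_ UC]]; exact: UC.
Qed.

(* In a compact space a clopen set is the union of finitely many members of the
   base B; there are not more finite subsets of B than elements of B. *)
Lemma card_clopen_le_basis (X : topologicalType) I (C : I -> set X)
    (B : set (set X)) :
    compact [set: X] -> infinite_set [set: I] -> injective C ->
    (forall i, clopen (C i)) -> basis B ->
  [set: I] #<= B.
Proof.
move=> Xcompact Iinf Cinj Cclopen Bbasis.
have /choice[D DP] i : exists D : {fset set X},
    {subset D <= B} /\ C i = \bigcup_(U in [set` D]) U.
  have [Co Cc] := Cclopen i; apply: compact_open_finite_union => //.
  exact: subclosed_compact Cc Xcompact (@subsetT _ _).
have Dinj : injective D by move=> i j Dij; apply: Cinj; rewrite !(DP _).2 Dij.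
(* A finite [B] has too few subsets for an injection from [I]; hence [B] is infinite and
   [card_seq_le] applies to it. *)
have [Bfin|Binf] := pselect (finite_set B).
  exfalso; apply: Iinf; have : finite_set (range D).
    apply: (sub_finite_set _ (finite_fset (fpowerset (fset_set B)))).
    move=> _ [i _ <-] /=; rewrite fpowersetE; apply/fsubsetP => U /(DP i).1.
    by rewrite in_fset_set.
  apply: card_le_finite.
  by have /card_eqPle[] := @inj_card_eq _ _ setT D (in2W Dinj).
have /choice[s sP] i : exists s : seq B, map val s = D i.
  by apply/seq_val_onto/allP => U /(DP i).1.
have sinj : injective s.
  by move=> i j sij; apply/Dinj/val_inj; rewrite /= -!sP sij.
apply: card_le_trans (card_le_injective sinj) _.
have BT : [set: B] #= B by exact: card_setT.
apply: card_le_trans (card_seq_le _) _; last by have /card_eqPle[] := BT.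
by rewrite (eq_finite_set BT).
Qed.

(** * Boolean isomorphisms as order isomorphisms *)

Section OrderIsomorphism.
Context d (A : ctbDistrLatticeType d) d' (A' : ctbDistrLatticeType d').
Local Open Scope order_scope.

Lemma ba_isomorphic_le : ba_isomorphic A A' ->
  exists2 f : A -> A', bijective f & {mono f : x y / x <= y}.
Proof.
move=> [f [fbij [fI _ _ _ _]]]; exists f => // x y.
by rewrite !leEmeet -fI (inj_eq (bij_inj fbij)).
Qed.

Lemma le_ba_isomorphic (f : A -> A') :
  bijective f -> {mono f : x y / x <= y} -> ba_isomorphic A A'.
Proof.
move=> fbij fmono; exists f; split=> //; have [g fK gK] := fbij.
have fI : {morph f : x y / x `&` y}.
  move=> x y; apply/le_anti/andP; split; first by rewrite lexI !fmono leIl leIr.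
  by rewrite -[leLHS]gK fmono lexI -!fmono gK leIl leIr.
have fU : {morph f : x y / x `|` y}.
  move=> x y; apply/le_anti/andP; split; last by rewrite leUx !fmono leUl leUr.
  by rewrite -[leRHS]gK fmono leUx -!fmono gK leUl leUr.
have f0 : f \bot = \bot by apply/eqP; rewrite -lex0 -[leRHS]gK fmono le0x.
have f1 : f \top = \top by apply/eqP; rewrite -le1x -[leLHS]gK fmono lex1.
(* The complement of [f x] is the largest element disjoint from it, and [f] preserves and reflects
   disjointness. *)
split=> // x; apply/le_anti/andP; split.
  by rewrite -disj_leC -fI meetCx f0.
by rewrite -[leLHS]gK fmono -disj_leC -(inj_eq (bij_inj fbij)) fI gK meetCx f0.
Qed.

Lemma ba_isomorphic_complete :
  ba_isomorphic A A' -> ba_complete A' -> ba_complete A.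
Proof.
move=> /ba_isomorphic_le[f [g fK gK] fmono] A'complete S.
have [m [mub mlub]] := A'complete (f @` S).
exists (g m); split=> [x Sx|y yub].
  by rewrite -fmono gK; apply: mub; exists x.
by rewrite -fmono gK; apply: mlub => _ [x Sx <-]; rewrite fmono; exact: yub.
Qed.

End OrderIsomorphism.

(** * Regular open algebras of semiregular spaces *)

Lemma RO_complete (X : topologicalType) : ba_complete (RO X).
Proof.
move=> S; exists (ro_mk (regopen_int_closure (\bigcup_(U in S) (U : set X)))).
split=> [U SU|V Vub].
  rewrite ro_leE; apply: open_sub_interior; first exact: ro_open.
  by apply: subset_trans (@subset_closure _ _); exact: bigcup_sup.
rewrite ro_leE -[ro_set V]ro_regopen; apply/interiorS/closureS.
by apply: bigcup_sub => U /Vub; rewrite ro_leE.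
Qed.

Lemma clopen_basis_semiregular (X : topologicalType) :
  has_clopen_basis X -> semiregular X.
Proof.
move=> [B [_ Bnbhs] Bclopen]; split=> [U /= <-|x U /Bnbhs[V [BV Vx] VU]].
  exact: open_interior.
have [oV cV] := Bclopen _ BV; exists V => //; split=> //.
by rewrite /regopen /= -(closure_id V).1// (interior_id _).1.
Qed.

(** A regular open [W] fits between the point and its neighbourhood; for a basic [U] inside [W],
    int(cl(U)) stays inside int(cl(W)) = [W]. *)
Lemma regularized_basis (X : topologicalType) (B : set (set X)) :
  semiregular X -> basis B -> basis [set (closure U)° | U in B].
Proof.
move=> [_ Xnbhs] [Bopen Bnbhs].
split=> [_ [U _ <-]|x V /Xnbhs[W [/= rW Wx] WV]]; first exact: open_interior.
have [|U [BU Ux] UW] := Bnbhs x W.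
  by apply: open_nbhs_nbhs; split=> //; rewrite -rW; exact: open_interior.
exists (closure U)°.
  split; first by exists U.
  by apply: (open_sub_interior (Bopen _ BU)) => //; exact: subset_closure.
by apply: subset_trans WV; rewrite -rW; exact/interiorS/closureS.
Qed.

Lemma BSR_dense (tau : Type) d (A : ctbDistrLatticeType d) : BSR tau A ->
  ba_complete A /\ exists2 B : set A, ba_dense B & B #= [set: tau].
Proof.
move=> [X [Xsr [[B Bbasis Btau] Xweight] isoA]]; split.
  exact: ba_isomorphic_complete isoA (@RO_complete X).
have [f [g fK gK] fmono] := ba_isomorphic_le isoA.
have Rbasis := regularized_basis Xsr Bbasis.
pose h (U : set X) : A := g (ro_mk (regopen_int_closure U)).
have fh U : f (h U) = (closure U)° :> set X by rewrite /h gK.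
exists (h @` B).
  move=> a a0; have [x ax] : (f a : set X) !=set0.
    apply/set0P; apply: contra_neq a0 => fa0.
    apply/(can_inj fK)/le_anti/andP.
    by split; [rewrite ro_leE fa0|rewrite fmono le0x].
  have /Rbasis.2[_ [[U BU <-] Ux] Ua] : nbhs x (f a : set X).
    by apply: open_nbhs_nbhs; split=> //; exact: ro_open.
  exists (h U); split; first by exists U.
    apply/eqP => hU0.
    have : (f (h U) <= \bot)%O by rewrite hU0 -[leRHS]gK fmono le0x.
    by rewrite ro_leE fh => /(_ x Ux).
  by rewrite -fmono ro_leE fh.
apply/card_eqPle; split.
  by apply: card_le_trans (card_image_le _ _) _; have /card_eqPle[] := Btau.
(* The regularized family is a base, so it has at least tau members, and it is the image under [f]
   of the dense set. *)
apply: card_le_trans (Xweight _ Rbasis) _.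
have <- : (fun a => f a : set X) @` (h @` B) = [set (closure U)° | U in B].
  by rewrite image_comp; apply: eq_imagel => U _ /=; rewrite fh.
exact: card_image_le.
Qed.

(** * From a dense subset to a compact space *)

Lemma space_weight d (A : ctbDistrLatticeType d) I (b : I -> A) :
  infinite_set [set: I] -> injective b -> weight_is (space b) I.
Proof.
move=> Iinf binj.
have lower (B : set (set (space b))) : basis B -> [set: I] #<= B.
  move=> Bbasis.
  apply: (@card_clopen_le_basis _ _ (fun i => cylinder b [:: (i, true)])) => //.
  - exact: space_compact.
  (* If [b i] were not below [b j], the word with [i] true and [j] false would have nonzero meet,
     giving a point of the first cylinder outside the second. *)
  - have sub i j : cylinder b [:: (i, true)] = cylinder b [:: (j, true)] ->
        (b i <= b j)%O.
      move=> eC; rewrite -[b j]complK -disj_leC; apply: contrapT => /negP ij0.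
      have [|x] := @cylinder_neq0 _ _ _ b [:: (i, true); (j, false)].
        by rewrite -cat1s word_meet_cat !word_meet1.
      rewrite -cat1s cylinder_cat eC !cylinder1 => -[/= ->].
      by [].
    by move=> i j eC; apply/binj/le_anti; rewrite !sub.
  - by move=> i; exact: clopen_cylinder.
split=> //; exists (range (cylinder b)); first exact: cylinder_basis.
apply/card_eqPle; split; last exact/lower/cylinder_basis.
exact: card_le_trans (card_image_le _ _) (card_seq_bool_le Iinf).
Qed.

Lemma space_isomorphic d (A : ctbDistrLatticeType d) I (b : I -> A) :
    ba_complete A ->
    (forall a : A, a != \bot%O -> exists2 i, b i != \bot%O & (b i <= a)%O) ->
  ba_isomorphic A (RO (space b)).
Proof.
move=> Acomplete bdense.
pose f a : RO (space b) := ro_mk (regopen_space_of bdense a).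
have fmono : {mono f : x y / (x <= y)%O}.
  move=> x y; apply/idP/idP; first by rewrite ro_leE; exact: space_of_subset.
  move=> xy; rewrite ro_leE => z [s sx zs]; exists s => //.
  exact: le_trans xy.
have /choice[g gK] (U : RO (space b)) : exists a, f a = U.
  have [a aU] := space_of_surj Acomplete (ro_regopen U).
  by exists a; exact: val_inj.
apply: (le_ba_isomorphic (f := f)) => //; exists g => // a.
by apply: (inc_inj fmono); rewrite gK.
Qed.

Lemma dense_BZK (tau : Type) d (A : ctbDistrLatticeType d) :
    infinite_set [set: tau] -> ba_complete A ->
    (exists2 B : set A, ba_dense B & B #= [set: tau]) ->
  BZK tau A.
Proof.
move=> tauinf Acomplete [B Bdense /card_eq_enum[b [binj bB]]].
exists (space b); split.
- exact: space_clopen_basis.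
- exact: space_compact.
- exact: space_hausdorff.
- exact: space_weight.
rewrite -bB in Bdense.
by apply: space_isomorphic => // a /Bdense[_ [[i _ <-] bi0 bia]]; exists i.
Qed.

Theorem theorem6p9 (d : Order.disp_t) (A : ctbDistrLatticeType d) (tau : Type)
    (tau_infinite : infinite_set [set: tau]) :
  [<-> BSR tau A;
       ba_complete A /\ (exists2 B : set A, ba_dense B & B #= [set: tau]);
       BZK tau A]
  /\ (forall (d' : Order.disp_t) (A' : ctbDistrLatticeType d'),
        BZ tau A' <-> BZK tau A').
Proof.
(* The inclusions of [BZ] in [BSR], [BSR] in [BZK] and [BZK] in [BZ] hold for every algebra and
   close both cycles; the middle one passes through (b). *)
have BZ_BSR d' (A' : ctbDistrLatticeType d') : BZ tau A' -> BSR tau A'.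
  by move=> [X [/clopen_basis_semiregular Xsr _ Xw iso]]; exists X.
have BZK_BZ d' (A' : ctbDistrLatticeType d') : BZK tau A' -> BZ tau A'.
  by move=> [X [Xcl _ XT2 Xw iso]]; exists X.
have BSR_BZK d' (A' : ctbDistrLatticeType d') : BSR tau A' -> BZK tau A'.
  by move=> /BSR_dense[Ac Ad]; exact: dense_BZK.
split; last by move=> d' A'; split=> [/BZ_BSR/BSR_BZK|/BZK_BZ].
tfae.
- exact: BSR_dense.
- by move=> [Ac Ad]; exact: dense_BZK.
- by move/BZK_BZ/BZ_BSR.
Qed.
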